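(* Let $\gamma:\widehat{G}\to(0,\infty)$ be a measurable function and let $s_2>s_1>0$ be real numbers. Then $\mathfrak{H}^{s_2}_\gamma(G,H)\hookrightarrow\mathfrak{H}^{s_1}_\gamma(G,H)$ (continuous embedding), and $$\|T\|_{\mathfrak{H}^{s_1}_\gamma(G,H)}\le\|T\|_{\mathfrak{H}^{s_2}_\gamma(G,H)}\qquad\text{for all }T\in\mathfrak{H}^{s_2}_\gamma(G,H).$$
   Context: Setting. $G$ is a locally compact abelian Hausdorff group with neutral element $e$ and Pontryagin dual $\widehat{G}$; $H$ is a separable complex Hilbert space. $U:G\to U(H)$, $x\mapsto U_x$, is a (strongly continuous) irreducible unitary projective representation of $G$ on $H$: $U_xU_y=m(x,y)U_{xy}$ for all $x,y\in G$, with multiplier $m:G\times G\to\mathbb{T}$ (the unit circle), and $U_e=I$. Put $\sigma(x,y)=m(x,y)/m(y,x)$, so that $U_xU_y=\sigma(x,y)U_yU_x$. It is assumed that: $m$ is a Heisenberg multiplier, i.e. $x\mapsto\sigma(x,\cdot)$ is a topological isomorphism from $G$ onto $\widehat{G}$; $m(x,y)=m(x^{-1},y^{-1})$ for all $x,y\in G$; $U$ is square integrable, i.e. there are non-zero $\phi,\psi\in H$ with $x\mapsto\langle U_x\phi,\psi\rangle$ in $L^2(G)$; and $U$ is integrable, i.e. there is a non-zero $\psi\in H$ with $x\mapsto\langle U_x\psi,\psi\rangle$ in $L^1(G)$. One identifies $\widehat{G}$ with $G$ through $\sigma$: for $\xi=\sigma(x,\cdot)\in\widehat{G}$ one writes $U_\xi:=U_x$.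 Schatten classes. For $1\le p<\infty$, $S_p(H)$ is the space of compact operators on $H$ whose singular values are $p$-summable, with norm $\|T\|_{S_p(H)}$ equal to the $\ell^p$ norm of the singular values. $S_1(H)$ is the trace class and $S_2(H)$ the Hilbert-Schmidt class. Quantum Fourier transform. For $T\in S_1(H)$, $\mathcal{F}_U(T)(\xi)=\mathrm{tr}(TU_\xi^* )$, $\xi\in\widehat{G}$. The Haar measure $d\xi$ on $\widehat{G}$ is normalized so that the (known) Plancherel theorem holds: $\mathcal{F}_U$ extends (uniquely) from $S_1(H)$ to a unitary operator $\mathcal{F}_U:S_2(H)\to L^2(\widehat{G})$. This extension defines $\mathcal{F}_U$ on $S_2(H)$. Quantum Sobolev space. For $s>0$, $$\mathfrak{H}^s_\gamma(G,H)=\left\{T\in S_2(H) : \int_{\widehat{G}}(1+\gamma(\xi)^2)^s|\mathcal{F}_U(T)(\xi)|^2\,d\xi<\infty\right\},\quad \|T\|_{\mathfrak{H}^s_\gamma(G,H)}=\left(\int_{\widehat{G}}(1+\gamma(\xi)^2)^s|\mathcal{F}_U(T)(\xi)|^2\,d\xi\right)^{1/2}.$$ Embeddings. For Banach spaces $X,Y$, $X\hookrightarrow Y$ means $X\subset Y$ and there is a constant $C>0$ with $\|x\|_Y\le C\|x\|_X$ for all $x\in X$. *)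

(* Defs.v *)
From HB Require Import structures.
From mathcomp Require Import all_boot all_order all_algebra.
From mathcomp Require Import all_classical all_reals all_analysis.
From mathcomp Require Export complex.

Set Implicit Arguments.
Unset Strict Implicit.
Unset Printing Implicit Defensive.

Import Order.TTheory GRing.Theory Num.Theory.
Import numFieldNormedType.Exports.

Local Open Scope classical_set_scope.
Local Open Scope complex_scope.
Local Open Scope ring_scope.

(* A complex Hilbert space. The inner product is linear in its first and
   conjugate-linear in its second argument; the norm of a normed module over
   R[i] takes its (real) values in R[i]. *)
HB.mixin Record isHilbert (R : realType) H & CompleteNormedModule R[i] H := {
  inner : {dot H for @conjc R} ;
  inner_norm : forall x : H, `|x| ^+ 2 = inner x x
}.

#[short(type="hilbertType")]
HB.structure Definition Hilbert (R : realType) :=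
  {H of CompleteNormedModule R[i] H & isHilbert R H}.

Arguments inner {R s}.

Definition cmod (R : realType) (z : R[i]) : R := complex.Re `|z|.

Definition separable_space (T : topologicalType) : Prop :=
  exists D : set T, countable D /\ dense D.

(* Abelian groups are written additively, and so is the pointwise product of
   characters. *)

Record dual (R : realType) (G : topologicalZmodType) : Type := Dual {
  dual_fun :> G -> R[i] ;
  dual_continuous : continuous (dual_fun : G -> R[i]^o) ;
  dual_norm : forall x, `|dual_fun x| = 1 ;
  dualD : forall x y, dual_fun (x + y) = dual_fun x * dual_fun y
}.

Section DualGroup.
Variables (R : realType) (G : topologicalZmodType).
Implicit Types xi eta : dual R G.

HB.instance Definition _ := gen_eqMixin (dual R G).
HB.instance Definition _ := gen_choiceMixin (dual R G).

Lemma dual_ext xi eta : (forall x, xi x = eta x) -> xi = eta.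
Proof.
case: xi eta => [f fc fn fD] [g gc gn gD] /= /funext fg; subst g.
by congr Dual; exact: Prop_irrelevance.
Qed.

Lemma dual_neq0 xi x : xi x != 0.
Proof. by rewrite -normr_eq0 dual_norm oner_eq0. Qed.

Definition dual_zero : dual R G.
Proof.
apply: (@Dual R G (fun=> 1)) => [x|x|x y].
- exact: cvg_cst.
- by rewrite normr1.
- by rewrite mulr1.
Defined.

Definition dual_add xi eta : dual R G.
Proof.
apply: (@Dual R G (fun x => xi x * eta x)) => [x|x|x y].
- by apply: (@cvgM R[i]); exact: dual_continuous.
- by rewrite normrM !dual_norm mulr1.
- by rewrite !dualD mulrACA.
Defined.

Definition dual_opp xi : dual R G.
Proof.
apply: (@Dual R G (fun x => (xi x)^-1)) => [x|x|x y].
- apply: (@cvgV R[i]); last exact: dual_continuous.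
  exact: dual_neq0.
- by rewrite normrV ?unitfE ?dual_neq0// dual_norm invr1.
- by rewrite dualD invfM.
Defined.

Fact dual_addA : associative dual_add.
Proof. by move=> a b c; apply: dual_ext => x /=; rewrite mulrA. Qed.
Fact dual_addC : commutative dual_add.
Proof. by move=> a b; apply: dual_ext => x /=; rewrite mulrC. Qed.
Fact dual_add0 : left_id dual_zero dual_add.
Proof. by move=> a; apply: dual_ext => x /=; rewrite mul1r. Qed.
Fact dual_addN : left_inverse dual_zero dual_opp dual_add.
Proof. by move=> a; apply: dual_ext => x /=; rewrite mulVf// dual_neq0. Qed.

HB.instance Definition _ :=
  GRing.isZmodule.Build (dual R G) dual_addA dual_addC dual_add0 dual_addN.

HB.instance Definition _ := Topological.copy (dual R G)
  (initial_topology (@dual_fun R G : dual R G -> {compact-open, G -> R[i]^o})).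

End DualGroup.

Definition borel (X : PreTopologicalZmodule.type) : Type := X.

Section Borel.
Variable X : PreTopologicalZmodule.type.
HB.instance Definition _ := Choice.on (borel X).
HB.instance Definition _ := isPointed.Build (borel X) (0 : X).
HB.instance Definition _ :=
  Measurable.copy (borel X) (g_sigma_algebraType (@open X : set_system (borel X))).
End Borel.

(* A Haar measure: a non-zero translation-invariant Radon measure, i.e. a Borel
   measure finite on compact sets, outer regular on Borel sets and inner regular
   on open sets. *)
Definition haar (R : realType) (X : PreTopologicalZmodule.type)
    (mu : {measure set (borel X) -> \bar R}) : Prop :=
  [/\ exists A : set X, measurable (A : set (borel X)) /\ mu A != 0%E,
      forall (a : X) (A : set X), measurable (A : set (borel X)) ->
        mu [set a + x | x in A] = mu A,
      forall K : set X, compact K -> measurable (K : set (borel X)) ->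
        (mu K < +oo)%E,
      forall A : set X, measurable (A : set (borel X)) ->
        mu A = ereal_inf [set mu O | O in [set O : set X | open O /\ A `<=` O]] &
      forall O : set X, open O ->
        mu O = ereal_sup [set mu K | K in [set K : set X | compact K /\ K `<=` O]]].

Section ComplexLp.
Context d (T : measurableType d) (R : realType).
Variable mu : {measure set T -> \bar R}.

Definition cLnorm (p : R) (f : T -> R[i]) : \bar R :=
  'N[mu]_(p%:E)[(fun x => (cmod (f x))%:E)].

Definition cLp (p : R) (f : T -> R[i]) : Prop :=
  [/\ measurable_fun setT (fun x => complex.Re (f x)),
      measurable_fun setT (fun x => complex.Im (f x)) &
      (cLnorm p f < +oo)%E].

End ComplexLp.

Section Operators.
Variables (R : realType) (H : hilbertType R).
Implicit Types (T S : H -> H) (e : nat -> H).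

Definition compact_operator T : Prop :=
  linear T /\ precompact [set T v | v in [set v : H | `|v| <= 1]].

Definition unitary_operator T : Prop :=
  [/\ linear T, forall v w, inner (T v) (T w) = inner v w &
      forall w, exists v, T v = w].

(* Exists and is unique for every bounded operator. *)
Definition adjoint T : H -> H :=
  xget (fun=> 0) [set S | forall v w, inner (T v) w = inner v (S w)].

(* The n-th (from 0) largest eigenvalue, counted with multiplicity, of
   (T^* T)^(1/2), and 0 when these eigenvalues are exhausted. *)
Definition singular_value T (n : nat) : R :=
  sup [set l : R | 0 <= l /\
    exists (v : 'I_n.+1 -> H) (mu : 'I_n.+1 -> R),
      (forall i j, inner (v i) (v j) = (i == j)%:R) /\
      (forall i, l <= mu i /\
                 adjoint T (T (v i)) = ((mu i) ^+ 2)%:C *: v i)].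

Definition schatten_sum (p : R) T : \bar R :=
  (\sum_(0 <= n <oo) ((singular_value T n) `^ p)%:E)%E.

Definition schatten (p : R) : set (H -> H) :=
  [set T | compact_operator T /\ (schatten_sum p T < +oo)%E].

Definition schatten_norm (p : R) T : R := (fine (schatten_sum p T)) `^ p^-1.

(* Zero vectors are allowed as padding, so that bases of finite-dimensional
   spaces are also indexed by nat. *)
Definition orthonormal_basis e : Prop :=
  [/\ forall i j, i != j -> inner (e i) (e j) = 0,
      forall i, e i = 0 \/ `|e i| = 1 &
      forall v, series (fun i => inner v (e i) *: e i) @ \oo --> v].

(* For trace-class operators the limit exists and does not depend on the basis. *)
Definition trace T : R[i] :=
  xget 0 [set t : R[i] | forall e, orthonormal_basis e ->
    series (fun i => inner (T (e i)) (e i) : R[i]^o) @ \oo --> (t : R[i]^o)].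

End Operators.

Section ProjectiveRepresentation.
Variables (R : realType) (G : topologicalZmodType) (H : hilbertType R).
Variables (m : G -> G -> R[i]) (U : G -> H -> H).

Definition projective_representation : Prop :=
  [/\ forall x, unitary_operator (U x),
      forall v, continuous (fun x => U x v),
      forall x y, `|m x y| = 1,
      forall x y v, U x (U y v) = m x y *: U (x + y) v &
      forall v, U 0 v = v].

Definition irreducible_representation : Prop :=
  forall V : set H, closed V -> V 0 ->
    (forall (a : R[i]) v w, V v -> V w -> V (a *: v + w)) ->
    (forall x v, V v -> V (U x v)) ->
    V = [set 0] \/ V = setT.

Definition symplectic (x y : G) : R[i] := m x y / m y x.

Definition heisenberg_multiplier : Prop :=
  exists (iota : G -> dual R G) (iota' : dual R G -> G),
    [/\ forall x y, iota x y = symplectic x y,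
        {morph iota : x y / x + y},
        cancel iota iota' /\ cancel iota' iota,
        continuous iota & continuous iota'].

(* The point x with xi = symplectic x, which identifies the dual with G. *)
Definition dual_point (xi : dual R G) : G :=
  xget 0 [set x | forall y, symplectic x y = xi y].

Definition square_integrable (nu : {measure set (borel G) -> \bar R}) : Prop :=
  exists phi psi : H, [/\ phi != 0, psi != 0 &
    cLp nu 2 (fun x => inner (U x phi) psi)].

Definition integrable_representation
    (nu : {measure set (borel G) -> \bar R}) : Prop :=
  exists2 psi : H, psi != 0 & cLp nu 1 (fun x => inner (U x psi) psi).

Definition fourier1 (T : H -> H) (xi : dual R G) : R[i] :=
  trace (T \o adjoint (U (dual_point xi))).

Variable mu : {measure set (borel (dual R G)) -> \bar R}.

(* F extends fourier1 to a unitary operator from the Hilbert-Schmidt class onto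
   L^2; elements of L^2 are represented by functions, up to equality almost
   everywhere. *)
Definition unitary_extension (F : (H -> H) -> dual R G -> R[i]) : Prop :=
  [/\ forall T, schatten 1 T ->
        {ae mu, forall xi, F T xi = fourier1 T xi},
      forall (a : R[i]) T S, schatten 2 T -> schatten 2 S ->
        {ae mu, forall xi, F (fun v => a *: T v + S v) xi = a * F T xi + F S xi},
      forall T, schatten 2 T -> cLp mu 2 (F T),
      forall T, schatten 2 T -> cLnorm mu 2 (F T) = (schatten_norm 2 T)%:E &
      forall f : dual R G -> R[i], cLp mu 2 f ->
        exists2 T, schatten 2 T & {ae mu, forall xi, F T xi = f xi}].

Definition plancherel : Prop := exists F, unitary_extension F.

Definition fourier2 : (H -> H) -> dual R G -> R[i] :=
  xget (fun _ _ => 0) unitary_extension.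

Variable gamma : dual R G -> R.

Definition sobolev_integral (s : R) (T : H -> H) : \bar R :=
  (\int[mu]_xi
     ((1 + gamma xi ^+ 2) `^ s * cmod (fourier2 T xi) ^+ 2)%:E)%E.

Definition sobolev (s : R) : set (H -> H) :=
  [set T | schatten 2 T /\ (sobolev_integral s T < +oo)%E].

Definition sobolev_norm (s : R) (T : H -> H) : R :=
  Num.sqrt (fine (sobolev_integral s T)).

End ProjectiveRepresentation.

Definition continuously_embedded (R : realType) (E : Type)
    (X : set E) (normX : E -> R) (Y : set E) (normY : E -> R) : Prop :=
  X `<=` Y /\
  exists2 C : R, 0 < C & forall x, X x -> normY x <= C * normX x.

(* Main.v *)
(* Since 1 + gamma^2 >= 1, the weight (1 + gamma^2)^s is nondecreasing in s. *)

Require Import Defs.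
From mathcomp Require Import all_boot all_order all_algebra.
From mathcomp Require Import all_classical all_reals all_analysis.

Import Order.TTheory GRing.Theory Num.Theory.
Import numFieldNormedType.Exports.

Local Open Scope classical_set_scope.
Local Open Scope complex_scope.
Local Open Scope ring_scope.

(** Both norms integrate the same density [cmod (fourier2 T xi) ^+ 2] against powers of a base that
    is at least 1, so raising the exponent can only raise the integrand. Integrating gives
    [sobolev_integral_le], which passes finiteness from [s2] down to [s1]; taking square roots gives
    [sobolev_norm_le], that is, an embedding with constant 1. *)

(* Unlike [ge0_le_integral], no measurability is needed: the integral of a
   nonnegative function is a supremum over the simple functions below it. *)
Lemma le_integral_nonneg d (T : measurableType d) (R : realType)
    (mu : {measure set T -> \bar R}) (f g : T -> \bar R) :
  (forall x, 0 <= f x)%E -> (forall x, f x <= g x)%E ->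
  (\int[mu]_x f x <= \int[mu]_x g x)%E.
Proof.
move=> f0 fg; have g0 x : (0 <= g x)%E by exact: le_trans (fg x).
rewrite !ge0_integralTE//; apply: ereal_sup_le => _ [h hf <-].
by exists h => // x; exact: le_trans (fg x).
Qed.

Section SobolevMonotone.
Context (R : realType) (G : topologicalZmodType) (H : hilbertType R).
Context (m : G -> G -> R[i]) (U : G -> H -> H).
Context (mu : {measure set (borel (dual R G)) -> \bar R}) (gamma : dual R G -> R).

Lemma sobolev_integral_ge0 (s : R) (T : H -> H) :
  (0 <= sobolev_integral m U mu gamma s T)%E.
Proof.
by apply: integral_ge0 => xi _; rewrite lee_fin mulr_ge0 ?powR_ge0 ?sqr_ge0.
Qed.

Lemma sobolev_integral_le (s t : R) (T : H -> H) : s <= t ->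
  (sobolev_integral m U mu gamma s T <= sobolev_integral m U mu gamma t T)%E.
Proof.
move=> st; apply: le_integral_nonneg => xi; rewrite lee_fin.
  by rewrite mulr_ge0 ?powR_ge0 ?sqr_ge0.
(* [ler_powR] requires a base at least 1, and [lerDl] reduces this to [gamma xi ^+ 2] being
   nonnegative. *)
by rewrite ler_wpM2r ?sqr_ge0// ler_powR// lerDl sqr_ge0.
Qed.

(** Since [fine] sends [+oo] to 0, an infinite integral at [t] would give norm 0 and could break the
    inequality; finiteness at [t] also forces finiteness at [s]. *)
Lemma sobolev_norm_le (s t : R) (T : H -> H) : s <= t ->
  (sobolev_integral m U mu gamma t T < +oo)%E ->
  sobolev_norm m U mu gamma s T <= sobolev_norm m U mu gamma t T.
Proof.
move=> st tfin; have le_st := sobolev_integral_le _ _ T st.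
rewrite ler_wsqrtr// fine_le// ge0_fin_numE ?sobolev_integral_ge0//.
exact: le_lt_trans tfin.
Qed.

End SobolevMonotone.

Theorem theorem3p4 (R : realType)
    (G : topologicalZmodType)
    (hausdorffG : hausdorff_space G)
    (locally_compactG : locally_compact [set: G])
    (H : hilbertType R)
    (separableH : separable_space H)
    (m : G -> G -> R[i]) (U : G -> H -> H)
    (projU : projective_representation m U)
    (irrU : irreducible_representation U)
    (heisenberg_m : heisenberg_multiplier m)
    (m_opp : forall x y : G, m x y = m (- x) (- y))
    (nu : {measure set (borel G) -> \bar R}) (haar_nu : haar nu)
    (sqintU : square_integrable U nu)
    (intU : integrable_representation U nu)
    (mu : {measure set (borel (dual R G)) -> \bar R}) (haar_mu : haar mu)
    (plancherel_mu : plancherel m U mu)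
    (gamma : borel (dual R G) -> R)
    (gamma_meas : measurable_fun [set: borel (dual R G)] gamma)
    (gamma_gt0 : forall xi, 0 < gamma xi)
    (s1 s2 : R) (s1_gt0 : 0 < s1) (s1_lt_s2 : s1 < s2) :
  continuously_embedded
    (sobolev m U mu gamma s2) (sobolev_norm m U mu gamma s2)
    (sobolev m U mu gamma s1) (sobolev_norm m U mu gamma s1) /\
  forall T : H -> H, sobolev m U mu gamma s2 T ->
    sobolev_norm m U mu gamma s1 T <= sobolev_norm m U mu gamma s2 T.
Proof.
have le_norm T : sobolev m U mu gamma s2 T ->
    sobolev_norm m U mu gamma s1 T <= sobolev_norm m U mu gamma s2 T.
  by move=> [_ T2fin]; apply: sobolev_norm_le => //; exact: ltW.
split=> //; split=> [T [T2 T2fin]|].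
  by split=> //; apply: le_lt_trans T2fin; apply: sobolev_integral_le; exact: ltW.
by exists 1 => // T /le_norm; rewrite mul1r.
Qed.
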